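(* Let $d\ge 2$ be an integer, let $\lambda_n>0$ and $\beta_n\in\mathbb{R}$ ($n\ge 0$). The Jacobi operator $J$ on $\ell^2(\Gamma_d)$ (with domain the finitely supported functions) is essentially selfadjoint if and only if the corresponding one dimensional Jacobi operator $J^r$ on $\ell^2(\mathbb{N}_0)$ (with domain the finitely supported sequences) is essentially selfadjoint.
   Context: $\Gamma_d$ is the vertex set of the infinite rooted tree with root $e$ in which every vertex $x$ has exactly $d$ successors (children) $x_1,\dots,x_d$ and every vertex $x\ne e$ has exactly one predecessor (parent) $x_0$. The length $|x|$ is the graph distance from $x$ to $e$. $\ell^2(\Gamma_d)$ is the complex Hilbert space of square-summable functions on $\Gamma_d$, and $\delta_x$ is the characteristic function of $\{x\}$. The operator $J$ has domain $D(J)=\operatorname{lin}\{\delta_x: x\in\Gamma_d\}$ and acts by $$J\delta_x=\lambda_{n-1}\delta_{x_0}+\beta_n\delta_x+\lambda_n(\delta_{x_1}+\dots+\delta_{x_d}),\qquad n=|x|,$$ where for $x=e$ the first term is absent (convention $\lambda_{-1}=0$). It is a symmetric operator. The operator $J^r$ has domain $\operatorname{lin}\{\delta_0,\delta_1,\dots\}\subset\ell^2(\mathbb{N}_0)$ and acts by $$J^r\delta_n=\sqrt d\,\lambda_{n-1}\delta_{n-1}+\beta_n\delta_n+\sqrt d\,\lambda_n\delta_{n+1},\qquad n\ge 0,\ \lambda_{-1}=0$$ (it corresponds to the restriction of $J$ to functions constant on the levels $\{|x|=n\}$ of $\Gamma_d$). A symmetric operator is essentially selfadjoint if its closure is selfadjoint.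 *)

(* Defs.v *)
From HB Require Import structures.
From mathcomp Require Import all_boot all_order all_algebra.
From mathcomp Require Import complex.
From mathcomp Require Import all_classical reals ereal numfun esum.

Set Implicit Arguments.
Unset Strict Implicit.
Unset Printing Implicit Defensive.
Import Order.TTheory GRing.Theory Num.Theory.
Local Open Scope classical_set_scope.
Local Open Scope complex_scope.
Local Open Scope ring_scope.

Section l2.
Context {R : realType} {X : choiceType}.
Implicit Types (f g u v : X -> R[i]).

(* The squared norm, +oo when f is not square-summable. *)
Definition sqnorm f : \bar R :=
  (\esum_(x in [set: X]) (Normc.normc (f x) ^+ 2)%:E)%E.

Definition l2 : set (X -> R[i]) := [set f | (sqnorm f < +oo)%E].

(* Sums of absolutely summable families; \esum is only meaningful for
   nonnegative terms, hence the splitting into positive and negative parts.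
   The value is irrelevant for families that are not absolutely summable. *)
Definition real_sum (a : X -> R) : R :=
  fine (\esum_(x in [set: X]) ((EFin \o a)^\+ x))%E -
  fine (\esum_(x in [set: X]) ((EFin \o a)^\- x))%E.

Definition complex_sum (a : X -> R[i]) : R[i] :=
  real_sum (fun x => complex.Re (a x)) +i* real_sum (fun x => complex.Im (a x)).

Definition inner f g : R[i] := complex_sum (fun x => f x * (g x)^*).

Definition delta (x : X) : X -> R[i] := fun y => (y == x)%:R.

(* An unbounded operator A in l2 is represented by its graph: A (f, g) means
   that f is in the domain of A and A f = g. *)
Definition operator := set ((X -> R[i]) * (X -> R[i])).

Implicit Type A : operator.

(* The domain consists of the finitely supported functions, that is, the linear
   span of the delta x; the operator is the linear one mapping each delta x to
   e x. *)
Definition operator_on_basis (e : X -> X -> R[i]) : operator :=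
  [set p | finite_set [set x | p.1 x != 0] /\
     p.2 = fun y => \sum_(x \in [set x | p.1 x != 0]) p.1 x * e x y].

Definition densely_defined A : Prop :=
  forall f, l2 f -> forall eps : R, 0 < eps ->
  exists u v, A (u, v) /\ (sqnorm (u \- f)%R < (eps ^+ 2)%:E)%E.

(* The closure of the graph in l2 x l2. *)
Definition op_closure A : operator :=
  [set p | l2 p.1 /\ l2 p.2 /\ forall eps : R, 0 < eps ->
     exists u v, [/\ A (u, v),
       (sqnorm (u \- p.1)%R < (eps ^+ 2)%:E)%E &
       (sqnorm (v \- p.2)%R < (eps ^+ 2)%:E)%E]].

Definition adjoint A : operator :=
  [set p | l2 p.1 /\ l2 p.2 /\
     forall u v, A (u, v) -> inner v p.1 = inner u p.2].

(* The adjoint of a densely defined graph is single-valued, so that no separate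
   functionality condition is needed here. *)
Definition selfadjoint A : Prop := densely_defined A /\ adjoint A = A.

Definition essentially_selfadjoint A : Prop := selfadjoint (op_closure A).

End l2.

Arguments operator R X : clear implicits.

(* Vertices of the rooted d-ary tree: the root is [::], the children of x are
   the i :: x for i : 'I_d, and the parent of i :: x is x; |x| is size x. *)
Definition tree (d : nat) := seq 'I_d.
HB.instance Definition _ (d : nat) := Countable.on (tree d).

Section jacobi.
Context {R : realType}.
Variables (d : nat) (lambda beta : nat -> R).

Definition tree_jacobi_delta (x : tree d) : tree d -> R[i] := fun y =>
  (if x is _ :: x0 then (lambda (size x0))%:C * delta x0 y else 0)
  + (beta (size x))%:C * delta x y
  + (lambda (size x))%:C * \sum_(i < d) delta (i :: x) y.

Definition tree_jacobi : operator R (tree d) :=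
  operator_on_basis tree_jacobi_delta.

Definition line_jacobi_delta (n : nat) : nat -> R[i] := fun k =>
  (if n is m.+1 then (Num.sqrt d%:R * lambda m)%:C * delta m k else 0)
  + (beta n)%:C * delta n k
  + (Num.sqrt d%:R * lambda n)%:C * delta n.+1 k.

Definition line_jacobi : operator R nat :=
  operator_on_basis line_jacobi_delta.

End jacobi.

Arguments tree_jacobi {R} d lambda beta.
Arguments line_jacobi {R} d lambda beta.

(* Main.v *)
Require Import Defs.
From mathcomp Require Import all_boot all_order all_algebra.
From mathcomp Require Import complex.
From mathcomp Require Import finmap.
From mathcomp Require Import all_classical reals ereal numfun esum.
From mathcomp Require Import ring lra zify.

(* The adjoint of the closure of J is the maximal operator, so J is essentially
   selfadjoint iff every f with f and J f square-summable is a limit, in the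
   graph norm, of finitely supported functions; likewise for J^r. Radial
   functions on the subtree below a vertex y form an isometric copy of the
   sequences supported on n >= |y|, and normalized level sums give a
   contraction backwards; both maps intertwine J and J^r up to boundary terms
   at y and its parent. With y = e this transfers approximations from J to J^r.
   Conversely, replacing f beyond level N by its averages over descendants of a
   level-N vertex at equal depth commutes with J, converges to f in the graph
   norm as N grows, and produces a finitely supported function plus finitely
   many radial functions on subtrees, each approximable by the essential
   selfadjointness of J^r. *)

Set Implicit Arguments.
Unset Strict Implicit.
Unset Printing Implicit Defensive.
Import Order.TTheory GRing.Theory Num.Theory.
Local Open Scope classical_set_scope.
Local Open Scope complex_scope.
Local Open Scope ring_scope.

(** * Squared norms and square-summable functions *)

Section sqnorm.
Context {R : realType} {X : choiceType}.
Implicit Types (f g u v : X -> R[i]) (z w : R[i]).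

(** Squared modulus as a polynomial in the two coordinates, within reach of [ring] and [lra]. *)
Definition csq z : R := complex.Re z ^+ 2 + complex.Im z ^+ 2.

Lemma normc_sqr z : Normc.normc z ^+ 2 = csq z.
Proof. by case: z => a b; rewrite /= sqr_sqrtr // addr_ge0 ?sqr_ge0. Qed.

Lemma csq_ge0 z : 0 <= csq z.
Proof. by rewrite addr_ge0 ?sqr_ge0. Qed.

Lemma csq0 : csq 0 = 0.
Proof. by rewrite /csq /= expr0n addr0. Qed.

Lemma csqN z : csq (- z) = csq z.
Proof. by case: z => a b; rewrite /csq /= !sqrrN. Qed.

Lemma csqM z w : csq (z * w) = csq z * csq w.
Proof. by case: z w => a b [c e]; rewrite /csq /=; ring. Qed.

Lemma csqR (a : R) : csq a%:C = a ^+ 2.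
Proof. by rewrite /csq /= expr0n addr0. Qed.

(** The slack is the squared modulus of [z - w] (parallelogram law). *)
Lemma csqD z w : csq (z + w) <= 2 * (csq z + csq w).
Proof.
case: z w => a b [c e]; rewrite /csq /= -subr_ge0.
have -> : 2 * (a ^+ 2 + b ^+ 2 + (c ^+ 2 + e ^+ 2)) -
  ((a + c) ^+ 2 + (b + e) ^+ 2) = (a - c) ^+ 2 + (b - e) ^+ 2 by ring.
by rewrite addr_ge0 ?sqr_ge0.
Qed.

Lemma sqnormE f : sqnorm f = (\esum_(x in [set: X]) (csq (f x))%:E)%E.
Proof. by apply: eq_esum => x _; rewrite normc_sqr. Qed.

Lemma sqnorm_ge0 f : (0 <= sqnorm f)%E.
Proof. by rewrite sqnormE; apply: esum_ge0 => x _; rewrite lee_fin csq_ge0. Qed.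

Lemma l2_fin f : l2 f -> sqnorm f \is a fin_num.
Proof. by move=> lf; rewrite ge0_fin_numE ?sqnorm_ge0. Qed.

Lemma sqnormN f : sqnorm (\- f) = sqnorm f.
Proof. by rewrite !sqnormE; apply: eq_esum => x _; rewrite csqN. Qed.

Lemma sqnormD f g :
  (sqnorm (f \+ g)%R <= 2%:E * (sqnorm f + sqnorm g))%E.
Proof.
have cge0 h x : [set: X] x -> (0 <= (csq ((h : X -> R[i]) x))%:E)%E.
  by rewrite lee_fin csq_ge0.
rewrite !sqnormE -esumD; [|exact: cge0|exact: cge0].
rewrite mule_natl mule2n -esumD; last 2 first.
- by move=> x _; apply: adde_ge0; exact: cge0.
- by move=> x _; apply: adde_ge0; exact: cge0.
apply: le_esum => x _; rewrite -!EFinD lee_fin.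
by apply: le_trans (csqD _ _) _; rewrite mulr_natl mulr2n.
Qed.

(** The factor 2 in [sqnormD], applied to two terms below [eps / 4], gives [eps]; later
    approximations quarter the tolerance for this reason. *)
Lemma sqnormD_lt f g (eps : R) : (sqnorm f < (eps / 4)%:E)%E ->
  (sqnorm g < (eps / 4)%:E)%E -> (sqnorm (f \+ g)%R < eps%:E)%E.
Proof.
move=> fe ge; apply: le_lt_trans (sqnormD f g) _.
have fF : sqnorm f \is a fin_num by exact: l2_fin (lt_trans fe (ltry _)).
have gF : sqnorm g \is a fin_num by exact: l2_fin (lt_trans ge (ltry _)).
move: fe ge; rewrite -(fineK fF) -(fineK gF) -EFinD -EFinM !lte_fin.
by lra.
Qed.

Lemma l2D f g : l2 f -> l2 g -> l2 (f \+ g).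
Proof.
move=> lf lg; apply: le_lt_trans (sqnormD f g) _.
by rewrite -(fineK (l2_fin lf)) -(fineK (l2_fin lg)) -EFinD -EFinM ltry.
Qed.

Lemma l2N f : l2 f -> l2 (\- f).
Proof. by rewrite /l2 /= sqnormN. Qed.

Lemma l2B f g : l2 f -> l2 g -> l2 (f \- g).
Proof. by move=> lf /l2N; exact: l2D. Qed.

Lemma sqnorm_point f x : ((csq (f x))%:E <= sqnorm f)%E.
Proof.
rewrite sqnormE; apply: esum_ge; exists [set x]; first by split.
by rewrite fsbig_set1.
Qed.

Definition finsupp f := finite_set [set x | f x != 0].

Lemma finsupp_l2 f : finsupp f -> l2 f.
Proof.
move=> ff; rewrite /l2 /= sqnormE.
suff -> : (\esum_(x in [set: X]) (csq (f x))%:E =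
    \esum_(x in [set x | (f x != 0)%R]) (csq (f x))%:E)%E.
  rewrite esum_fset // => [|x _]; last by rewrite lee_fin csq_ge0.
  by rewrite fsumEFin // ltry.
rewrite [RHS]esum_mkcond; apply: eq_esum => x _.
case: ifPn => //; rewrite notin_setE /= => /negP; rewrite negbK => /eqP ->.
by rewrite csq0.
Qed.

Lemma finsuppD f g : finsupp f -> finsupp g -> finsupp (f \+ g).
Proof.
move=> ff gf; apply: (@sub_finite_set _ _ ([set x | f x != 0] `|` [set x | g x != 0])).
  move=> x /= fgx; have [fx|] := eqVneq (f x) 0; last by left.
  by right; move: fgx; rewrite fx add0r.
by rewrite finite_setU.
Qed.

(** The difference is finitely supported. This absorbs the finitely many levels at which radial sums
    may fail to commute with the Jacobi operators. *)
Lemma l2_eqoff (S : set X) f g : finite_set S ->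
  (forall x, ~ S x -> f x = g x) -> l2 g -> l2 f.
Proof.
move=> fS fg lg; have -> : f = (f \- g) \+ g by apply/funext => x /=; rewrite subrK.
apply: l2D => //; apply: finsupp_l2; apply: sub_finite_set fS => x /=.
by apply: contraPP => /fg ->; rewrite subrr eqxx.
Qed.

Lemma finsupp_dense f (eps : R) : l2 f -> 0 < eps ->
  exists u, finsupp u /\ (sqnorm (u \- f)%R < eps%:E)%E.
Proof.
move=> lf e0.
(* The sum is a supremum of finite partial sums, so some finite [S] captures all but less than
   [eps]; truncating [f] to [S] loses only the tail [b]. *)
have [_ [S [fS _] <-] Se] := ub_ereal_sup_adherent e0
  (eq_ind _ (fun y => y \is a fin_num) (l2_fin lf) _ (sqnormE f)).
exists (fun x => if x \in S then f x else 0); split.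
  apply: sub_finite_set fS => x /=; case: ifPn; first by rewrite inE.
  by rewrite eqxx.
have fin_lf := l2_fin lf; move: Se fin_lf.
change (ereal_sup _) with (\esum_(x in [set: X]) (csq (f x))%:E)%E.
have cge0 x : [set: X] x -> (0 <= (csq (f x))%:E)%E by rewrite lee_fin csq_ge0.
rewrite !sqnormE (esumID S) // !setTI -esum_fset //; last first.
  by move=> x _; rewrite lee_fin csq_ge0.
set a := esum _ _; set b := esum _ _ => abe.
rewrite fin_numD => /andP[af bf].
suff -> : (\esum_(x in [set: X])
  (csq (((fun x => if x \in S then f x else 0%R) \- f)%R x))%:E = b)%E.
  move: abe; rewrite -(fineK af) -(fineK bf) -EFinD !lte_fin.
  by lra.
rewrite /b [RHS]esum_mkcond; apply: eq_esum => x _ /=.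
rewrite in_setC; case: ifPn => xS /=; first by rewrite subrr csq0.
by rewrite sub0r csqN.
Qed.

End sqnorm.

(** * Sums of absolutely summable real families *)

Section real_sum.
Context {R : realType} {X : choiceType}.
Implicit Types (a b p q : X -> R).

Definition abs_summable a := summable [set: X] (EFin \o a).

Lemma le_abs_summable a b : (forall x, `|a x| <= b x) -> abs_summable b ->
  abs_summable a.
Proof.
move=> ab; apply: le_lt_trans; apply: le_esum => x _.
by rewrite lee_fin; apply: le_trans (ab x) (ler_norm _).
Qed.

Lemma abs_summableD a b : abs_summable a -> abs_summable b ->
  abs_summable (fun x => a x + b x).
Proof. by move=> sa sb; have := summableD sa sb. Qed.

Lemma abs_summableN a : abs_summable a -> abs_summable (fun x => - a x).
Proof. by rewrite /abs_summable summableN. Qed.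

Definition nnsum p : R := fine (\esum_(x in [set: X]) (p x)%:E)%E.

Lemma abs_summable_fin p : (forall x, 0 <= p x) -> abs_summable p ->
  (\esum_(x in [set: X]) (p x)%:E)%E \is a fin_num.
Proof.
move=> p0 sp; rewrite ge0_fin_numE; last first.
  by apply: esum_ge0 => x _; rewrite lee_fin.
by apply: le_lt_trans sp; apply: le_esum => x _; rewrite lee_fin ler_norm.
Qed.

Lemma nnsumK p : (forall x, 0 <= p x) -> abs_summable p ->
  (nnsum p)%:E = (\esum_(x in [set: X]) (p x)%:E)%E.
Proof. by move=> p0 sp; rewrite fineK // abs_summable_fin. Qed.

Lemma nnsum_ge0 p : (forall x, 0 <= p x) -> 0 <= nnsum p.
Proof.
by move=> p0; apply: fine_ge0; apply: esum_ge0 => x _; rewrite lee_fin.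
Qed.

Lemma nnsumD p q : (forall x, 0 <= p x) -> (forall x, 0 <= q x) ->
  abs_summable p -> abs_summable q ->
  nnsum (fun x => p x + q x) = nnsum p + nnsum q.
Proof.
move=> p0 q0 sp sq; rewrite -fineD; [|exact: abs_summable_fin..].
by rewrite -esumD // => x _; rewrite lee_fin.
Qed.

Lemma le_nnsum p q : (forall x, 0 <= p x) -> (forall x, p x <= q x) ->
  abs_summable q -> nnsum p <= nnsum q.
Proof.
move=> p0 pq sq; have q0 x : 0 <= q x := le_trans (p0 x) (pq x).
have sp : abs_summable p by apply: le_abs_summable sq => x; rewrite ger0_norm.
by rewrite -lee_fin !nnsumK //; apply: le_esum => x _; rewrite lee_fin.
Qed.

(** The sum does not depend on the splitting into a difference of nonnegative summable families.
    Additivity rests on this, since positive parts are not additive. *)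
Lemma real_sum_sub p q : (forall x, 0 <= p x) -> (forall x, 0 <= q x) ->
  abs_summable p -> abs_summable q ->
  real_sum (fun x => p x - q x) = nnsum p - nnsum q.
Proof.
move=> p0 q0 sp sq; rewrite /real_sum.
have spq : abs_summable (fun x => p x - q x).
  by apply: abs_summableD => //; exact: abs_summableN.
have fpos (h : X -> \bar R) : (forall x, 0 <= h x)%E -> summable [set: X] h ->
    (\esum_(x in [set: X]) h x)%E \is a fin_num.
  move=> h0; rewrite summableE; congr (_ \is a fin_num).
  by apply: eq_esum => x _; rewrite gee0_abs.
rewrite -!fineB; first last.
- by apply: fpos; [exact: funeneg_ge0|exact: (summable_funeneg spq)].
- by apply: fpos; [exact: funepos_ge0|exact: (summable_funepos spq)].
- exact: abs_summable_fin.
- exact: abs_summable_fin.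
congr fine.
by apply: (@esumB R X [set: X] (EFin \o p) (EFin \o q)) => // x _; rewrite lee_fin.
Qed.

Let pos a x : R := Num.max (a x) 0.
Let neg a x : R := Num.max (- a x) 0.

Let pos_ge0 a x : 0 <= pos a x. Proof. by rewrite le_max lexx orbT. Qed.
Let neg_ge0 a x : 0 <= neg a x. Proof. by rewrite le_max lexx orbT. Qed.

Let pos_neg a x : a x = pos a x - neg a x.
Proof.
rewrite /pos /neg; case/orP: (le_total 0 (a x)) => a0.
  by rewrite max_l // max_r ?oppr_le0 // subr0.
by rewrite max_r // max_l ?sub0r ?opprK // oppr_ge0.
Qed.

Let pos_le a x : pos a x <= `|a x|.
Proof. by rewrite ge_max ler_norm normr_ge0. Qed.

Let neg_le a x : neg a x <= `|a x|.
Proof. by rewrite ge_max -normrN ler_norm normr_ge0. Qed.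

Let abs_summable_norm a : abs_summable a -> abs_summable (fun x => `|a x|).
Proof.
move=> sa; apply: le_lt_trans sa; apply: le_esum => x _.
by rewrite /= lee_fin normr_id.
Qed.

Let pos_summable a : abs_summable a -> abs_summable (pos a).
Proof.
move/abs_summable_norm; apply: le_abs_summable => x.
by rewrite ger0_norm.
Qed.

Let neg_summable a : abs_summable a -> abs_summable (neg a).
Proof.
move/abs_summable_norm; apply: le_abs_summable => x.
by rewrite ger0_norm.
Qed.

Let real_sumE a : abs_summable a -> real_sum a = nnsum (pos a) - nnsum (neg a).
Proof.
move=> sa; rewrite -real_sum_sub //; [|exact: pos_summable|exact: neg_summable].
by congr real_sum; apply/funext => x; exact: pos_neg.
Qed.

Lemma real_sumD a b : abs_summable a -> abs_summable b ->
  real_sum (fun x => a x + b x) = real_sum a + real_sum b.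
Proof.
move=> sa sb.
have sp := pos_summable sa; have sn := neg_summable sa.
have sp' := pos_summable sb; have sn' := neg_summable sb.
transitivity (real_sum (fun x => (pos a x + pos b x) - (neg a x + neg b x))).
  congr real_sum; apply/funext => x.
  by rewrite [a x]pos_neg [b x]pos_neg opprD addrACA.
rewrite real_sum_sub; first last.
- exact: abs_summableD.
- exact: abs_summableD.
- by move=> x; rewrite addr_ge0.
- by move=> x; rewrite addr_ge0.
by rewrite !nnsumD // !real_sumE // opprD addrACA.
Qed.

Lemma real_sumN a : abs_summable a -> real_sum (fun x => - a x) = - real_sum a.
Proof.
move=> sa; rewrite (real_sumE sa) opprB -real_sum_sub //; last first.
- exact: pos_summable.
- exact: neg_summable.
by congr real_sum; apply/funext => x; rewrite {1}[a x]pos_neg opprB.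
Qed.

(** Both [nnsum (pos a)] and [nnsum (neg a)] lie between 0 and [nnsum b], hence so does the modulus
    of their difference. *)
Lemma real_sum_le a b : (forall x, `|a x| <= b x) -> abs_summable b ->
  `|real_sum a| <= nnsum b.
Proof.
move=> ab sb; have sa := le_abs_summable ab sb; rewrite real_sumE //.
have pb x : pos a x <= b x := le_trans (pos_le a x) (ab x).
have nb x : neg a x <= b x := le_trans (neg_le a x) (ab x).
have := le_nnsum (pos_ge0 a) pb sb; have := le_nnsum (neg_ge0 a) nb sb.
have := nnsum_ge0 (pos_ge0 a); have := nnsum_ge0 (neg_ge0 a).
by rewrite ler_norml; lra.
Qed.

Lemma real_sum_point z a : (forall x, x != z -> a x = 0) -> real_sum a = a z.
Proof.
move=> az; rewrite /real_sum.
have esum_point (h : X -> \bar R) : (forall x, 0 <= h x)%E ->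
    (forall x, x != z -> h x = 0%E) -> (\esum_(x in [set: X]) h x = h z)%E.
  move=> h0 hz; rewrite (esumID [set z]) // setTI esum_set1 // setTI esum1.
    by rewrite adde0.
  by move=> x /eqP /hz.
rewrite !esum_point //.
- by rewrite funeposE funenegE /= -!EFin_max /= {3}[a z]pos_neg.
- by move=> x /az ax; rewrite funenegE /= ax oppr0 maxxx.
- by move=> x /az ax; rewrite funeposE /= ax maxxx.
Qed.

End real_sum.

(** * The inner product and its continuity *)

Section inner.
Context {R : realType} {X : choiceType}.
Implicit Types (f g u v : X -> R[i]).

(* AM-GM with a weight [t], which is later chosen small. *)
Lemma normrM_le (x y t : R) : 0 < t -> `|x * y| <= t * y ^+ 2 + t^-1 * x ^+ 2.
Proof.
move=> t0; have tn0 : t != 0 by rewrite gt_eqF.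
have P : 0 <= t^-1 * (x + t * y) ^+ 2 by rewrite mulr_ge0 ?invr_ge0 ?sqr_ge0 ?ltW.
have M : 0 <= t^-1 * (x - t * y) ^+ 2 by rewrite mulr_ge0 ?invr_ge0 ?sqr_ge0 ?ltW.
have A : 0 <= t * y ^+ 2 by rewrite mulr_ge0 ?sqr_ge0 ?ltW.
have B : 0 <= t^-1 * x ^+ 2 by rewrite mulr_ge0 ?invr_ge0 ?sqr_ge0 ?ltW.
have PE : t^-1 * (x + t * y) ^+ 2 = t * y ^+ 2 + t^-1 * x ^+ 2 + 2 * (x * y) by field.
have ME : t^-1 * (x - t * y) ^+ 2 = t * y ^+ 2 + t^-1 * x ^+ 2 - 2 * (x * y) by field.
by rewrite ler_norml; move: P M A B; rewrite PE ME; lra.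
Qed.

Lemma normr_ReM (z w : R[i]) (t : R) : 0 < t ->
  `|complex.Re (z * w^*)| <= t * csq w + t^-1 * csq z.
Proof.
case: z w => a b [c e] t0; rewrite /csq /= mulrN opprK.
have := normrM_le a c t0; have := normrM_le b e t0.
have := ler_normD (a * c) (b * e); rewrite !mulrDr; lra.
Qed.

Lemma normr_ImM (z w : R[i]) (t : R) : 0 < t ->
  `|complex.Im (z * w^*)| <= t * csq w + t^-1 * csq z.
Proof.
case: z w => a b [c e] t0; rewrite /csq /= mulrN.
have := normrM_le a e t0; have := normrM_le b c t0.
have := ler_normD (- (a * e)) (b * c); rewrite normrN !mulrDr; lra.
Qed.

Lemma csq_summable f : l2 f -> abs_summable (fun x => csq (f x)).
Proof.
rewrite /l2 /= sqnormE; apply: le_lt_trans; apply: le_esum => x _.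
by rewrite /= ger0_norm // csq_ge0.
Qed.

Lemma nnsum_csq f : l2 f -> (nnsum (fun x => csq (f x)))%:E = sqnorm f.
Proof.
move=> lf; rewrite nnsumK ?sqnormE //; first by move=> x; exact: csq_ge0.
exact: csq_summable.
Qed.

Lemma nnsumZ (t : R) (p : X -> R) : 0 < t -> (forall x, 0 <= p x) ->
  abs_summable p -> abs_summable (fun x => t * p x) /\
  nnsum (fun x => t * p x) = t * nnsum p.
Proof.
move=> t0 p0 sp.
have E : (\esum_(x in [set: X]) (t * p x)%:E =
    t%:E * \esum_(x in [set: X]) (p x)%:E)%E.
  rewrite /esum -ereal_sup_pZl // image_comp; congr ereal_sup.
  apply: eq_imagel => S _; rewrite /= ge0_mule_fsumr //.
split; last by rewrite /nnsum E -nnsumK.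
rewrite /abs_summable /summable.
rewrite (eq_esum (b := fun x => (t * p x)%:E)); last first.
  by move=> x _; rewrite /= ger0_norm // mulr_ge0 // ltW.
by rewrite E -nnsumK // -EFinM ltry.
Qed.

Lemma inner_summable f g : l2 f -> l2 g ->
  abs_summable (fun x => complex.Re (f x * (g x)^*)) /\
  abs_summable (fun x => complex.Im (f x * (g x)^*)).
Proof.
move=> lf lg.
have s : abs_summable (fun x => csq (g x) + csq (f x)).
  by apply: abs_summableD; exact: csq_summable.
split; apply: le_abs_summable s => x.
  by have := normr_ReM (f x) (g x) ltr01; rewrite invr1 !mul1r.
by have := normr_ImM (f x) (g x) ltr01; rewrite invr1 !mul1r.
Qed.

Let addc_mk (a b c e : R) : (a +i* b) + (c +i* e) = (a + c) +i* (b + e).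
Proof. by []. Qed.

Let oppc_mk (a b : R) : - (a +i* b) = (- a) +i* (- b).
Proof. by []. Qed.

Lemma innerDl f g h : l2 f -> l2 g -> l2 h ->
  inner (f \+ g) h = inner f h + inner g h.
Proof.
move=> lf lg lh; have [fr fi] := inner_summable lf lh.
have [gr gi] := inner_summable lg lh; rewrite /inner /complex_sum /=.
rewrite addc_mk -!real_sumD //.
by congr (Complex _ _); congr real_sum; apply/funext => x;
  rewrite mulrDl; case: (f x * _); case: (g x * _).
Qed.

Lemma innerNl f h : l2 f -> l2 h -> inner (\- f) h = - inner f h.
Proof.
move=> lf lh; have [fr fi] := inner_summable lf lh; rewrite /inner /complex_sum /=.
rewrite oppc_mk -!real_sumN //.
by congr (Complex _ _); congr real_sum; apply/funext => x;
  rewrite mulNr; case: (f x * _).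
Qed.

Lemma innerBl f g h : l2 f -> l2 g -> l2 h ->
  inner (f \- g) h = inner f h - inner g h.
Proof. by move=> lf lg lh; rewrite -innerNl // -innerDl //; exact: l2N. Qed.

Lemma inner_point z f g : (forall x, x != z -> f x = 0) ->
  inner f g = f z * (g z)^*.
Proof.
move=> fz; rewrite /inner /complex_sum.
rewrite !(@real_sum_point _ _ z) //; first by case: (f z * _).
  by move=> x /fz ->; rewrite mul0r.
by move=> x /fz ->; rewrite mul0r.
Qed.

Lemma inner0l g : l2 g -> inner (fun=> 0) g = 0.
Proof.
move=> lg; have E : (fun=> 0) = g \- g by apply/funext => x /=; rewrite subrr.
by rewrite E innerBl // subrr.
Qed.

(** Summed form of the weighted AM-GM bound, in the role of Cauchy-Schwarz: a small [t] handles a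
    fixed [g], after which [f] must be small relative to [t]. *)
Lemma inner_bound f g (t : R) : l2 f -> l2 g -> 0 < t ->
  let b := t * fine (sqnorm g) + t^-1 * fine (sqnorm f) in
  `|complex.Re (inner f g)| <= b /\ `|complex.Im (inner f g)| <= b.
Proof.
move=> lf lg t0 b; have ti : 0 < t^-1 by rewrite invr_gt0.
have [sg eg] := nnsumZ t0 (fun x => csq_ge0 (g x)) (csq_summable lg).
have [sf ef] := nnsumZ ti (fun x => csq_ge0 (f x)) (csq_summable lf).
have -> : b = nnsum (fun x => t * csq (g x) + t^-1 * csq (f x)).
  rewrite nnsumD // ?eg ?ef; first by rewrite /b -!nnsum_csq.
    by move=> x; rewrite mulr_ge0 ?csq_ge0 ?ltW.
  by move=> x; rewrite mulr_ge0 ?csq_ge0 ?ltW.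
have s := abs_summableD sg sf.
split; apply: real_sum_le => // x; [exact: normr_ReM|exact: normr_ImM].
Qed.

(** The defect at the limit equals [inner (u' \- u) g - inner (v' \- v) f], which [inner_bound]
    makes arbitrarily small. Adjointness relations thus survive graph limits. *)
Lemma inner_limit f g u v : l2 f -> l2 g -> l2 u -> l2 v ->
  (forall eps : R, 0 < eps -> exists u' v', [/\ l2 u', l2 v',
     (sqnorm (u' \- u)%R < eps%:E)%E, (sqnorm (v' \- v)%R < eps%:E)%E &
     inner v' f = inner u' g]) ->
  inner v f = inner u g.
Proof.
move=> lf lg lu lv app; apply/eqP; rewrite -subr_eq0.
set z := _ - _.
have small (eta : R) : 0 < eta ->
    `|complex.Re z| < eta /\ `|complex.Im z| < eta.
  move=> eta0.
  have F0 : 0 <= fine (sqnorm f) by apply: fine_ge0; exact: sqnorm_ge0.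
  have G0 : 0 <= fine (sqnorm g) by apply: fine_ge0; exact: sqnorm_ge0.
  set F := fine _ in F0; set G := fine _ in G0.
  (* With this [t] the two fixed terms total less than [eta / 2]; the summand 1 keeps the
     denominator positive when [f] and [g] both vanish. *)
  pose t := eta / (2 * (F + G + 1)).
  have t0 : 0 < t by rewrite divr_gt0 // mulr_gt0 //; lra.
  have tFG : t * (F + G) < eta / 2.
    have -> : eta / 2 = t * (F + G + 1).
      by rewrite /t; field; rewrite gt_eqF //; lra.
    by rewrite ltr_pM2l //; lra.
  (* After division by [t] each approximation error is below [eta / 4]; the two fill the other half
     of [eta]. *)
  have e0 : 0 < t * (eta / 4) by rewrite mulr_gt0 // divr_gt0.
  have [u' [v' [lu' lv' uu' vv' uv]]] := app _ e0.
  have -> : z = inner (u' \- u) g - inner (v' \- v) f.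
    by rewrite !innerBl // uv /z; ring.
  have lu'u := l2B lu' lu; have lv'v := l2B lv' lv.
  have [Ru Iu] := inner_bound lu'u lg t0; have [Rv Iv] := inner_bound lv'v lf t0.
  have fu : t^-1 * fine (sqnorm (u' \- u)%R) < eta / 4.
    rewrite mulrC ltr_pdivrMr // mulrC -lte_fin fineK //; exact: l2_fin.
  have fv : t^-1 * fine (sqnorm (v' \- v)%R) < eta / 4.
    rewrite mulrC ltr_pdivrMr // mulrC -lte_fin fineK //; exact: l2_fin.
  have tE : t * (F + G) = t * F + t * G by ring.
  move: (inner (u' \- u) g) (inner (v' \- v) f) Ru Iu Rv Iv => [a b] [c e] /=.
  rewrite -/F -/G => Ru Iu Rv Iv.
  have := ler_normB a c; have := ler_normB b e; split; lra.
have z0 (r : R) : (forall eta, 0 < eta -> `|r| < eta) -> r = 0.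
  move=> h; apply/eqP; rewrite -normr_eq0; apply/negPn/negP => r0.
  by have := h `|r|; rewrite ltxx lt_def r0 normr_ge0 => /(_ isT).
have Re0 : complex.Re z = 0 by apply: z0 => eta /small[].
have Im0 : complex.Im z = 0 by apply: z0 => eta /small[].
by rewrite eq_complex Re0 Im0 /= !eqxx.
Qed.

End inner.

(** * Finitely supported functions *)

Section finsupp.
Context {R : realType} {X : choiceType}.
Implicit Types (f g u v : X -> R[i]).

Lemma deltaxx (x : X) : delta x x = 1 :> R[i].
Proof. by rewrite /delta eqxx. Qed.

Lemma delta_neq (x y : X) : y != x -> delta x y = 0 :> R[i].
Proof. by rewrite /delta => /negbTE ->. Qed.

Lemma finsupp_delta c (x : X) : finsupp (fun y => c * delta x y : R[i]).
Proof.
apply: (@sub_finite_set _ _ [set x]) => // y /=.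
by case: (eqVneq y x) => // yx; rewrite delta_neq // mulr0 eqxx.
Qed.

(** Induction over a list containing the support: zeroing the value at the head leaves a function
    supported in the tail. *)
Lemma finsupp_ind (P : (X -> R[i]) -> Prop) : P (fun=> 0) ->
  (forall u x c, P u -> P (u \+ (fun y => c * delta x y))) ->
  forall u, finsupp u -> P u.
Proof.
move=> P0 PS.
have ind (s : seq X) : forall u, (forall x, u x != 0 -> x \in s) -> P u.
  elim: s => [u us|z s IH u us].
    suff -> : u = fun=> 0 by [].
    by apply/funext => x; apply/eqP/negPn/negP => /us.
  pose w x := if x == z then 0 else u x.
  have -> : u = w \+ (fun y => u z * delta z y).
    apply/funext => x /=; rewrite /w; case: (eqVneq x z) => [->|xz].
      by rewrite deltaxx add0r mulr1.
    by rewrite delta_neq // mulr0 addr0.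
  apply: PS; apply: IH => x; rewrite /w; case: (eqVneq x z) => [_|xz /us].
    by rewrite eqxx.
  by rewrite inE (negbTE xz).
move=> u /finite_seqP[s us]; apply: (ind s) => x ux.
have : [set x | u x != 0] x by [].
by rewrite us.
Qed.

Lemma inner_conj f g : l2 f -> l2 g -> (inner f g)^* = inner g f.
Proof.
move=> lf lg; have [_ si] := inner_summable lf lg.
apply/eqP; rewrite eq_complex /= -real_sumN //.
by apply/andP; split; apply/eqP; congr real_sum; apply/funext => x;
  case: (f x) (g x) => a b [c e] /=; ring.
Qed.

(** [m] serves as a level function: [size] on the tree, [id] on the line. *)
Lemma finsupp_bound (m : X -> nat) f :
  finsupp f -> exists M, forall x, (M < m x)%N -> f x = 0.
Proof.
move=> /finite_seqP[r fr]; exists (\max_(x <- r) m x)%N => x Mx.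
apply/eqP; apply: contraTT Mx => fx; rewrite -leqNgt.
have : [set x | f x != 0] x by [].
by rewrite fr => xr; exact: leq_bigmax_seq.
Qed.

End finsupp.

(** * Weighted graph operators and a criterion for essential selfadjointness *)

Section graph.
Context {R : realType} {X : choiceType}.
Variable nb : X -> seq (X * R).
Implicit Types (f g u v : X -> R[i]).

(* The weighted adjacency operator of the graph with neighbourhoods [nb]. *)
Definition gop f x : R[i] := \sum_(p <- nb x) p.2%:C * f p.1.

Lemma gopD f g : gop (f \+ g) = gop f \+ gop g.
Proof.
apply/funext => x /=; rewrite /gop -big_split /=.
by apply: eq_bigr => p _; rewrite mulrDr.
Qed.

Lemma gopN f : gop (\- f) = \- gop f.
Proof.
apply/funext => x /=; rewrite /gop -sumrN.
by apply: eq_bigr => p _; rewrite mulrN.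
Qed.

Lemma gopB f g : gop (f \- g) = gop f \- gop g.
Proof. by rewrite -[RHS]/(gop f \+ (\- gop g)) -gopN -gopD. Qed.

Lemma gopZ c f : gop (fun y => c * f y) = fun y => c * gop f y.
Proof.
apply/funext => x; rewrite /gop mulr_sumr.
by apply: eq_bigr => p _; rewrite mulrCA.
Qed.

Lemma gop0 : gop (fun=> 0) = fun=> 0.
Proof. by apply/funext => x; rewrite /gop big1 // => p _; rewrite mulr0. Qed.

Lemma gop_sum (I : Type) (r : seq I) (F : I -> X -> R[i]) :
  gop (fun y => \sum_(i <- r) F i y) = fun y => \sum_(i <- r) gop (F i) y.
Proof.
apply/funext => x; rewrite /gop exchange_big /=; apply: eq_bigr => p _.
by rewrite mulr_sumr.
Qed.

(** For [f] and [gop f] square-summable this says that [(f, gop f)] lies in the closure of the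
    operator on finitely supported functions. The tolerance bounds squared norms. *)
Definition approximable f := forall eps : R, 0 < eps -> exists u,
  [/\ finsupp u, (sqnorm (u \- f)%R < eps%:E)%E &
      (sqnorm (gop (u \- f)%R) < eps%:E)%E].

Lemma approximable_limit f :
  (forall eps : R, 0 < eps -> exists g, [/\ approximable g,
     (sqnorm (g \- f)%R < eps%:E)%E & (sqnorm (gop (g \- f)%R) < eps%:E)%E]) ->
  approximable f.
Proof.
move=> H eps e0; have e4 : 0 < eps / 4 by rewrite divr_gt0.
have [g [ag gf Tgf]] := H _ e4; have [u [fu ug Tug]] := ag _ e4.
exists u; have -> : u \- f = (u \- g) \+ (g \- f).
  by apply/funext => x /=; rewrite addrA subrK.
by split=> //; [|rewrite gopD]; exact: sqnormD_lt.
Qed.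

Lemma sqnorm0 : sqnorm (fun _ : X => 0 : R[i]) = 0%E.
Proof. by rewrite sqnormE esum1 // => x _; rewrite csq0. Qed.

Lemma finsupp_approximable u : finsupp u -> approximable u.
Proof.
move=> fu eps e0; exists u.
have -> : u \- u = fun=> 0 by apply/funext => x /=; rewrite subrr.
by rewrite gop0 sqnorm0 lte_fin.
Qed.

Lemma approximableD f g : approximable f -> approximable g ->
  approximable (f \+ g).
Proof.
move=> af ag eps e0; have e4 : 0 < eps / 4 by rewrite divr_gt0.
have [u [fu uf Tuf]] := af _ e4; have [v [fv vg Tvg]] := ag _ e4.
exists (u \+ v); have -> : (u \+ v) \- (f \+ g) = (u \- f) \+ (v \- g).
  by apply/funext => x /=; rewrite opprD addrACA.
by split; [exact: finsuppD| |rewrite gopD]; exact: sqnormD_lt.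
Qed.

Lemma approximable_sum (I : Type) (r : seq I) (F : I -> X -> R[i]) :
  (forall i, approximable (F i)) -> approximable (fun x => \sum_(i <- r) F i x).
Proof.
move=> aF; elim: r => [|i r IH].
  apply: finsupp_approximable; apply: (@sub_finite_set _ _ set0) => // x /=.
  by rewrite big_nil eqxx.
have -> : (fun x => \sum_(j <- i :: r) F j x) =
    F i \+ (fun x => \sum_(j <- r) F j x).
  by apply/funext => x; rewrite big_cons.
exact: approximableD.
Qed.

Hypothesis gop_sym : forall x y, gop (delta x) y = gop (delta y) x.

(** Symmetry trades the column of [x] for its row, the finite list [nb x]; so [gop] preserves finite
    support. *)
Let gop_delta x : gop (delta x) = fun y => \sum_(p <- nb x) p.2%:C * delta p.1 y.
Proof.
apply/funext => y; rewrite gop_sym; apply: eq_bigr => p _.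
by rewrite /delta eq_sym.
Qed.

Let finsupp_nb (s : seq (X * R)) :
  finsupp (fun y => \sum_(p <- s) p.2%:C * delta p.1 y).
Proof.
elim: s => [|p s IH].
  by apply: (@sub_finite_set _ _ set0) => // x /=; rewrite big_nil eqxx.
have -> : (fun y => \sum_(q <- p :: s) q.2%:C * delta q.1 y) =
    (fun y => p.2%:C * delta p.1 y) \+ (fun y => \sum_(q <- s) q.2%:C * delta q.1 y).
  by apply/funext => x; rewrite big_cons.
by apply: finsuppD => //; exact: finsupp_delta.
Qed.

Let finsuppZ c u : finsupp u -> finsupp (fun y => c * u y).
Proof.
apply: sub_finite_set => x /=; apply: contraNneq => ->.
by rewrite mulr0.
Qed.

Lemma finsupp_gop u : finsupp u -> finsupp (gop u).
Proof.
move=> fu; apply: (finsupp_ind (P := fun u => finsupp (gop u))) fu => [|{}u x c IH].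
  by rewrite gop0; apply: (@sub_finite_set _ _ set0) => // x /=; rewrite eqxx.
by rewrite gopD gopZ gop_delta; apply: finsuppD => //; exact: finsuppZ.
Qed.

Let inner_nb c (s : seq (X * R)) f : l2 f ->
  inner (fun y => c * \sum_(p <- s) p.2%:C * delta p.1 y) f =
  c * \sum_(p <- s) p.2%:C * (f p.1)^*.
Proof.
move=> lf; elim: s => [|p s IH].
  have -> : (fun y => c * \sum_(q <- [::]) q.2%:C * delta q.1 y) = fun _ : X => 0.
    by apply/funext => y; rewrite big_nil mulr0.
  by rewrite inner0l // big_nil mulr0.
have -> : (fun y => c * \sum_(q <- p :: s) q.2%:C * delta q.1 y) =
    (fun y => c * p.2%:C * delta p.1 y) \+
    (fun y => c * \sum_(q <- s) q.2%:C * delta q.1 y).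
  by apply/funext => y; rewrite /= big_cons mulrDr mulrA.
rewrite innerDl //; first last.
- by apply: finsupp_l2; apply: finsuppZ; exact: finsupp_nb.
- by apply: finsupp_l2; exact: finsupp_delta.
rewrite IH (@inner_point _ _ p.1) => [|x xp]; last by rewrite delta_neq ?mulr0.
by rewrite big_cons mulrDr deltaxx mulr1 mulrA.
Qed.

Let conj_gop f x : (gop f x)^* = \sum_(p <- nb x) p.2%:C * (f p.1)^*.
Proof.
rewrite /gop rmorph_sum; apply: eq_bigr => p _.
by rewrite rmorphM; congr (_ * _); exact: conjc_real.
Qed.

Let inner_gop_delta x c f : l2 f ->
  inner (fun y => c * gop (delta x) y) f = c * (gop f x)^*.
Proof. by move=> lf; rewrite gop_delta inner_nb // conj_gop. Qed.

(** By linearity in [u] it suffices to treat a point mass, where both sides are the same multiple of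
    the conjugate of [gop f] at that point. Here [f] ranges over the maximal domain. *)
Lemma inner_gop u f : finsupp u -> l2 f -> l2 (gop f) ->
  inner (gop u) f = inner u (gop f).
Proof.
move=> fu lf lTf.
(* Finite support is carried along because additivity of [inner] asks for square-summable
   summands. *)
apply: (proj2 (finsupp_ind
  (P := fun u => finsupp u /\ inner (gop u) f = inner u (gop f)) _ _ fu)).
  split; first by apply: (@sub_finite_set _ _ set0) => // x /=; rewrite eqxx.
  by rewrite gop0 !inner0l.
move=> {fu}u x c [fu IH]; have fd := finsupp_delta c x; split; first exact: finsuppD.
rewrite gopD !innerDl // ?IH //.
- congr (_ + _); rewrite gopZ inner_gop_delta //.
  rewrite (@inner_point _ _ x) => [|y yx]; last by rewrite delta_neq ?mulr0.
  by rewrite deltaxx mulr1.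
- exact: finsupp_l2.
- exact: finsupp_l2.
- by apply: finsupp_l2; exact: finsupp_gop.
- by apply: finsupp_l2; exact: finsupp_gop.
Qed.

Definition gop_finsupp : operator R X :=
  [set p | finsupp p.1 /\ p.2 = gop p.1].

(** [e x] is the matrix column at [x]; expanding [u] in point masses over its support reduces the
    claim to linearity of [gop]. *)
Lemma operator_on_basisE (e : X -> X -> R[i]) :
  (forall x y, e x y = gop (delta x) y) -> operator_on_basis e = gop_finsupp.
Proof.
move=> eE.
suff sumE u : finsupp u ->
    (fun y => \sum_(x \in [set x | u x != 0]) u x * e x y) = gop u.
  by apply/seteqP; split=> -[u v] [/= fu /= ->]; split=> //=; rewrite sumE.
move=> fu; set S := [set x | _] in fu *.
have uE : u = fun y => \sum_(x <- fset_set S) u x * delta x y.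
  apply/funext => y; have [uy|uy] := eqVneq (u y) 0.
    rewrite uy big1_seq // => x /andP[_]; rewrite in_fset_set // inE /S /= => ux.
    by rewrite delta_neq ?mulr0 //; apply: contraNneq ux => <-; rewrite uy.
  rewrite (big_fsetD1 y) /=; last by rewrite in_fset_set // inE.
  rewrite deltaxx mulr1 big1_seq ?addr0 // => x /andP[_].
  by rewrite !inE => /andP[xy _]; rewrite delta_neq ?mulr0 // eq_sym.
rewrite [in RHS]uE gop_sum; apply/funext => y; rewrite fsbig_finite //.
by apply: eq_bigr => x _; rewrite gopZ eE.
Qed.

Let gop_finsupp_closure u : finsupp u -> op_closure gop_finsupp (u, gop u).
Proof.
move=> fu; split; first exact: finsupp_l2.
split=> [|eps e0]; first by apply: finsupp_l2; exact: finsupp_gop.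
exists u, (gop u); split=> //=.
  by have -> : u \- u = fun=> 0;
    [apply/funext => x /=; rewrite subrr|rewrite sqnorm0 lte_fin exprn_gt0].
by have -> : gop u \- gop u = fun=> 0;
  [apply/funext => x /=; rewrite subrr|rewrite sqnorm0 lte_fin exprn_gt0].
Qed.

Let closureP f g (eps : R) : op_closure gop_finsupp (f, g) -> 0 < eps ->
  exists u, [/\ finsupp u, (sqnorm (u \- f)%R < eps%:E)%E &
    (sqnorm (gop u \- g)%R < eps%:E)%E].
Proof.
(* [op_closure] bounds squared norms by [eps ^+ 2], so it is used at the square root of the
   tolerance. *)
move=> [_ [_ cl]] e0; have s0 : 0 < Num.sqrt eps by rewrite sqrtr_gt0.
have [u [v [[/= fu ->]]]] := cl _ s0.
by rewrite sqr_sqrtr ?ltW //= => uf Tuf; exists u.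
Qed.

(** The adjoint of the closure is the maximal operator, with domain all [f] such that [f] and
    [gop f] are square-summable. It contains the closure, and equality is exactly approximability in
    the graph norm. *)
Lemma essentially_selfadjointP : essentially_selfadjoint gop_finsupp <->
  forall f, l2 f -> l2 (gop f) -> approximable f.
Proof.
(* Maximal operator inside the adjoint: symmetry against finitely supported functions passes to the
   closure by [inner_limit]. *)
have max_adj f : l2 f -> l2 (gop f) ->
    adjoint (op_closure gop_finsupp) (f, gop f).
  move=> lf lTf; do 2 split=> //; move=> u v cl; case: (cl) => /= lu [lv _].
  apply: inner_limit => // eps e0; have [w [fw wu Twv]] := closureP cl e0.
  exists w, (gop w); split=> //; [exact: finsupp_l2| |exact: inner_gop].
  by apply: finsupp_l2; exact: finsupp_gop.
split=> [[_ adjE] f lf lTf eps e0|app].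
  have := max_adj _ lf lTf; rewrite adjE => /closureP /(_ e0)[u [fu uf Tuf]].
  by exists u; rewrite gopB.
split.
  move=> f lf eps e0; have e20 : 0 < eps ^+ 2 by rewrite exprn_gt0.
  have [u [fu uf]] := finsupp_dense lf e20.
  by exists u, (gop u); split=> //; exact: gop_finsupp_closure.
apply/seteqP; split=> -[f g].
  move=> [/= lf [lg adj]].
  (* Testing the adjoint relation on [delta x] determines [g x]. *)
  have gE : g = gop f.
    apply/funext => x.
    have fx : finsupp (delta x : X -> R[i]).
      suff -> : delta x = fun y => 1 * delta x y :> R[i] by exact: finsupp_delta.
      by apply/funext => y; rewrite mul1r.
    have := adj _ _ (gop_finsupp_closure fx).
    rewrite /= (@inner_point _ _ x (delta x)) => [|y yx]; last by rewrite delta_neq.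
    rewrite deltaxx mul1r.
    have -> : gop (delta x) = fun y => 1 * gop (delta x) y.
      by apply/funext => y; rewrite mul1r.
    by rewrite inner_gop_delta // mul1r => /(can_inj (@conjcK R)).
  do 2 split=> //; move=> eps e0 /=; have e20 : 0 < eps ^+ 2 by rewrite exprn_gt0.
  rewrite gE in lg *; have [u [fu uf Tuf]] := app f lf lg _ e20.
  by exists u, (gop u); split=> //; rewrite -gopB.
(* Closure inside the adjoint: both arguments are limits, so the symmetry relation is carried
   through two limits in turn. *)
move=> cl; case: (cl) => /= lf [lg _]; do 2 split=> //; move=> u v clu.
case: (clu) => /= lu [lv _].
apply: inner_limit => // eps e0; have [w [fw wu Twv]] := closureP clu e0.
have lw := finsupp_l2 fw; have lTw := finsupp_l2 (finsupp_gop fw).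
exists w, (gop w); split=> //.
(* Conjugation swaps the arguments, so that the limit can be taken in the second one as well. *)
rewrite -(inner_conj lf lTw) -(inner_conj lg lw); congr (_^*).
apply/esym; apply: inner_limit => // r r0; have [z [fz zf Tzg]] := closureP cl r0.
exists z, (gop z); split=> //; [exact: finsupp_l2| |exact: inner_gop].
by apply: finsupp_l2; exact: finsupp_gop.
Qed.

End graph.

(** * Iterated sums over children *)

Section children_sum.
Context {d : nat}.
Implicit Types (x y z w : tree d) (k n : nat).

(** The descendants of [y] after [k] generations are the [w ++ y] with [size w = k]; the [k]-th
    iterate of [chsum] sums over them. *)
Definition chsum (V : nmodType) (F : tree d -> V) x : V := \sum_(i < d) F (i :: x).

Lemma iter_chsum_cat (V : nmodType) (F : tree d -> V) k y z :
  iter k (@chsum V) F (z ++ y) = iter k (@chsum V) (fun w => F (w ++ y)) z.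
Proof. by elim: k z => //= k IH z; apply: eq_bigr => i _; rewrite -IH. Qed.

Lemma eq_iter_chsum (V : nmodType) (F G : tree d -> V) k y :
  (forall w, size w = k -> F (w ++ y) = G (w ++ y)) ->
  iter k (@chsum V) F y = iter k (@chsum V) G y.
Proof.
elim: k y => [|k IH] y FG; first exact: (FG [::]).
rewrite !iterS; apply: eq_bigr => i _; apply: IH => w wk.
by rewrite -cat_rcons; apply: FG; rewrite size_rcons wk.
Qed.

Lemma iter_chsum_level (V : nmodType) (h : nat -> V) k y :
  iter k (@chsum V) (fun x => h (size x)) y = h (size y + k)%N *+ d ^ k.
Proof.
elim: k y => [|k IH] y; first by rewrite addn0.
rewrite iterS /chsum (eq_bigr (fun=> h (size y + k.+1)%N *+ d ^ k)).
  by rewrite sumr_const card_ord -mulrnA -expnSr.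
by move=> i _; rewrite IH /= addSnnS.
Qed.

Lemma iter_chsumD (V : nmodType) (F : tree d -> V) m n y :
  iter (m + n) (@chsum V) F y = iter m (@chsum V) (iter n (@chsum V) F) y.
Proof. by rewrite iterD. Qed.

Lemma cat_left_inj y : injective (cat^~ y).
Proof.
move=> u v /= uv; have szuv : size u = size v.
  by apply/eqP; rewrite -(eqn_add2r (size y)) -!size_cat uv.
by apply/eqP; rewrite -(andbT (u == v)) -(eqxx y) -eqseq_cat // uv.
Qed.

Section real.
Context {R : realType}.
Implicit Types (a b : tree d -> R) (F G : tree d -> R[i]).

Lemma le_iter_chsum a b k y :
  (forall w, size w = k -> a (w ++ y) <= b (w ++ y)) ->
  iter k (@chsum R) a y <= iter k (@chsum R) b y.
Proof.
elim: k y => [|k IH] y ab; first exact: (ab [::]).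
rewrite !iterS; apply: ler_sum => i _; apply: IH => w wk.
by rewrite -cat_rcons; apply: ab; rewrite size_rcons wk.
Qed.

Lemma iter_chsumB F G k y : iter k (@chsum R[i]) (F \- G) y =
  iter k (@chsum R[i]) F y - iter k (@chsum R[i]) G y.
Proof.
by elim: k y => // k IH y; rewrite !iterS -sumrB; apply: eq_bigr => i _.
Qed.

(** Cauchy-Schwarz: [d] times the slack is the sum of the squares of [d * x i - S]. *)
Lemma sqr_sum_le (x : 'I_d -> R) :
  (\sum_(i < d) x i) ^+ 2 <= d%:R * \sum_(i < d) x i ^+ 2.
Proof.
case: (posnP d) => [d0|d0].
  by rewrite !big1 ?expr0n ?mulr0 // => i; have := ltn_ord i; rewrite [X in (_ < X)%N]d0.
set S := \sum_(i < d) x i.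
have : 0 <= \sum_(i < d) (d%:R * x i - S) ^+ 2.
  by apply: sumr_ge0 => i _; exact: sqr_ge0.
have -> : \sum_(i < d) (d%:R * x i - S) ^+ 2 =
    d%:R * (d%:R * (\sum_(i < d) x i ^+ 2) - S ^+ 2).
  rewrite (eq_bigr (fun i => d%:R ^+ 2 * x i ^+ 2 - 2 * d%:R * S * x i + S ^+ 2));
    last by move=> i _; ring.
  rewrite big_split sumrB -!mulr_sumr -/S sumr_const card_ord /=.
  by rewrite -[_ *+ d]mulr_natl; ring.
by rewrite pmulr_rge0 ?ltr0n // subr_ge0.
Qed.

Lemma csq_sum_le (z : 'I_d -> R[i]) :
  csq (\sum_(i < d) z i) <= d%:R * \sum_(i < d) csq (z i).
Proof.
have re : complex.Re (\sum_(i < d) z i) = \sum_(i < d) complex.Re (z i).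
  by elim/big_rec2: _ => // i a [b c] _ <-; case: (z i).
have im : complex.Im (\sum_(i < d) z i) = \sum_(i < d) complex.Im (z i).
  by elim/big_rec2: _ => // i a [b c] _ <-; case: (z i).
by rewrite /csq re im big_split /= mulrDr lerD ?sqr_sum_le.
Qed.

(** Cauchy-Schwarz once per generation, each time at the cost of a factor [d]. *)
Lemma csq_iter_chsum F k y : csq (iter k (@chsum R[i]) F y) <=
  d%:R ^+ k * iter k (@chsum R) (fun x => csq (F x)) y.
Proof.
elim: k y => [|k IH] y; first by rewrite mul1r.
rewrite !iterS; apply: le_trans (csq_sum_le _) _.
rewrite exprS -mulrA ler_wpM2l // mulr_sumr.
by apply: ler_sum => i _.
Qed.

End real.

End children_sum.

(** * Reindexing nonnegative sums along injections *)

Section esum_reindex.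
Context {R : realType} {X Y : choiceType}.
Variables (e : X -> Y) (a : Y -> \bar R).
Hypotheses (e_inj : injective e) (a_ge0 : forall y, (0 <= a y)%E).

Lemma esum_range :
  (\esum_(y in range e) a y = \esum_(x in [set: X]) a (e x))%E.
Proof.
apply: reindex_esum; split=> [x _|x y _ _ /e_inj //|_ [x _ <-]]; by exists x.
Qed.

Lemma esum_comp_le :
  (\esum_(x in [set: X]) a (e x) <= \esum_(y in [set: Y]) a y)%E.
Proof.
rewrite -esum_range (esumID (range e) [set: Y]) // setTI leeDl //.
exact: esum_ge0.
Qed.

Lemma esum_comp : (forall y, ~ range e y -> a y = 0%E) ->
  (\esum_(y in [set: Y]) a y = \esum_(x in [set: X]) a (e x))%E.
Proof.
move=> ae; rewrite (esumID (range e) [set: Y]) // setTI esum_range.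
by rewrite setTI [X in (_ + X)%E]esum1 ?adde0 // => y /ae.
Qed.

End esum_reindex.

(** * Sums over the tree, level by level *)

Section tree_esum.
Context {R : realType} {d : nat}.
Implicit Types (a : tree d -> R).

Lemma esum_level a n : (forall x, 0 <= a x) ->
  (\esum_(x in [set x : tree d | size x = n]) (a x)%:E =
   (iter n (@chsum d R) a [::])%:E)%E.
Proof.
elim: n a => [|n IH] a a0.
  rewrite (_ : [set x | _] = [set [::]]) ?esum_set1 ?lee_fin //.
  by apply/seteqP; split=> [[]|_ ->].
rewrite iterSr -IH; last by move=> x; exact: sumr_ge0.
have finI : finite_set [set: 'I_d] by exact: finite_finset.
have chE x : ((chsum a x)%:E = \esum_(i in [set: 'I_d]) (a (i :: x))%:E)%E.
  rewrite esum_fset ?fsumEFin ?fsbig_finite //; last by move=> i _; rewrite lee_fin.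
  congr EFin; apply: perm_big; apply: uniq_perm => [||i];
    rewrite ?index_enum_uniq ?fset_uniq //.
  by rewrite mem_index_enum in_fset_set // in_setT.
under [RHS]eq_esum do rewrite chE.
rewrite esum_esum; last by move=> x i _ _; rewrite lee_fin.
(* A vertex at level [n.+1] is a pair of a parent at level [n] and a child index. *)
apply: (@reindex_esum R (tree d * 'I_d)%type (tree d) _ _
  (fun p => p.2 :: p.1) (fun x => (a x)%:E)).
split.
- by move=> [x i] /= [<- _].
- by move=> [x i] [y j] _ _ /= [-> ->].
- by move=> [|i x] //= [xn]; exists (x, i).
Qed.

Lemma esum_tree a : (forall x, 0 <= a x) ->
  (\esum_(x in [set: tree d]) (a x)%:E =
   \esum_(n in [set: nat]) (iter n (@chsum d R) a [::])%:E)%E.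
Proof.
move=> a0; under [RHS]eq_esum do rewrite -esum_level //.
rewrite -esum_bigcupT; last 2 first.
- by move=> n m _ _ [x [/= <- <-]].
- by move=> x; rewrite lee_fin.
by congr esum; apply/seteqP; split=> // x _; exists (size x).
Qed.

Lemma esum_subtree a (y : tree d) : (forall x, 0 <= a x) ->
  (\esum_(w in [set: tree d]) (a (w ++ y))%:E =
   \esum_(n in [set: nat]) (iter n (@chsum d R) a y)%:E)%E.
Proof.
move=> a0; rewrite (esum_tree (a := fun w => a (w ++ y))) //.
by apply: eq_esum => n _; rewrite -iter_chsum_cat.
Qed.

Lemma finite_level n : finite_set [set x : tree d | (size x <= n)%N].
Proof.
elim: n => [|n IH].
  apply: (@sub_finite_set _ _ [set [::]]) => // x /=.
  by rewrite leqn0 size_eq0 => /eqP.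
apply: (@sub_finite_set _ _ ([set [::]] `|`
    (fun p : 'I_d * tree d => p.1 :: p.2) @` ([set: 'I_d] `*` [set x | (size x <= n)%N]))).
  by move=> [|i x] /= xn; [left|right; exists (i, x)].
by rewrite finite_setU; split=> //; apply: finite_image; exact: finite_setX.
Qed.

End tree_esum.

(** * The two Jacobi operators as symmetric graph operators *)

Section jacobi_graphs.
Context {R : realType} {d : nat}.
Variables (lambda beta : nat -> R).
Hypothesis d_gt0 : (0 < d)%N.
Implicit Types (x y z w : tree d) (F G : tree d -> R[i]) (g h : nat -> R[i]).

Let s : R := Num.sqrt d%:R.

Let s_gt0 : 0 < s. Proof. by rewrite sqrtr_gt0 ltr0n. Qed.

Let s_neq0 : s != 0. Proof. by rewrite gt_eqF. Qed.

Let s_sqr : s ^+ 2 = d%:R. Proof. by rewrite sqr_sqrtr // ler0n. Qed.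

(* [lambda_(n-1)], with [lambda_(-1) = 0]. *)
Definition lambda_pred n := if n is m.+1 then lambda m else 0.

(* The root is its own parent, with weight 0. *)
Definition tree_nb x : seq (tree d * R) :=
  (behead x, lambda_pred (size x)) :: (x, beta (size x)) ::
  [seq (i :: x, lambda (size x)) | i <- index_enum 'I_d].

Definition line_nb n : seq (nat * R) :=
  [:: (n.-1, s * lambda_pred n); (n, beta n); (n.+1, s * lambda n)].

Lemma gop_treeE F x : gop tree_nb F x =
  (lambda_pred (size x))%:C * F (behead x) + (beta (size x))%:C * F x +
  (lambda (size x))%:C * chsum F x.
Proof. by rewrite /gop !big_cons big_map /= addrA -mulr_sumr. Qed.

Lemma gop_lineE g n : gop line_nb g n =
  (s * lambda_pred n)%:C * g n.-1 + (beta n)%:C * g n +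
  (s * lambda n)%:C * g n.+1.
Proof. by rewrite /gop !big_cons big_nil addr0 addrA. Qed.

Let up (x y : tree d) : R[i] :=
  if x is _ :: x0 then (lambda (size x0))%:C * delta x0 y else 0.

(** Both sides detect that [y] is the parent of [x], from the lower and from the upper end of the
    edge; the weight is indexed by the level of the upper end. Symmetry of the tree operator
    follows. *)
Let upE x y : up x y = (lambda (size y))%:C * \sum_(i < d) delta x (i :: y).
Proof.
case: x => [|j x] /=.
  by rewrite big1 ?mulr0 // => i _; rewrite delta_neq.
case: (eqVneq y x) => [->|yx].
  rewrite deltaxx (bigD1 j) //= deltaxx big1 ?addr0 // => i ij.
  by rewrite delta_neq // eqseq_cons (negbTE ij).
rewrite delta_neq // big1 ?mulr0 // => i _.
by rewrite delta_neq // eqseq_cons (negbTE yx) andbF.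
Qed.

Let up_behead x y : up y x = (lambda_pred (size y))%:C * delta x (behead y).
Proof. by case: y => [|j y] /=; rewrite ?mul0r // /delta eq_sym. Qed.

Let delta_sym (X : choiceType) (x y : X) : delta x y = delta y x :> R[i].
Proof. by rewrite /delta eq_sym. Qed.

Let diag_sym (X : choiceType) (a : X -> R) (x y : X) :
  (a x)%:C * delta x y = (a y)%:C * delta y x :> R[i].
Proof.
by case: (eqVneq x y) => [->//|xy]; rewrite !delta_neq ?mulr0 ?mulr0 // eq_sym.
Qed.

Let gop_tree_delta x y :
  gop tree_nb (delta x) y = up y x + (beta (size y))%:C * delta x y + up x y.
Proof. by rewrite gop_treeE -up_behead [up x y]upE. Qed.

Lemma tree_jacobi_deltaE x y :
  tree_jacobi_delta lambda beta x y = gop tree_nb (delta x) y.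
Proof.
rewrite gop_tree_delta /tree_jacobi_delta -/(up x y).
rewrite (diag_sym (beta \o size) x y) /= [delta y x]delta_sym.
have -> : \sum_(i < d) delta (i :: x) y = \sum_(i < d) delta y (i :: x) :> R[i].
  by apply: eq_bigr => i _; exact: delta_sym.
by rewrite -upE; ring.
Qed.

Lemma gop_tree_sym x y : gop tree_nb (delta x) y = gop tree_nb (delta y) x.
Proof.
rewrite !gop_tree_delta [delta x y]delta_sym (diag_sym (beta \o size) y x) /=.
by rewrite [delta x y]delta_sym; ring.
Qed.

Let lup (m n : nat) : R[i] :=
  if m is k.+1 then (s * lambda k)%:C * delta k n else 0.

Let lupE m n : lup m n = (s * lambda n)%:C * delta m n.+1.
Proof.
case: m => [|k] /=; first by rewrite delta_neq ?mulr0.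
case: (eqVneq n k) => [->|nk]; first by rewrite !deltaxx.
by rewrite !delta_neq ?mulr0.
Qed.

Let lup_pred m n : lup n m = (s * lambda_pred n)%:C * delta m n.-1.
Proof. by case: n => [|n] /=; rewrite ?mulr0 ?mul0r // [delta n m]delta_sym. Qed.

Let gop_line_delta m n :
  gop line_nb (delta m) n = lup n m + (beta n)%:C * delta m n + lup m n.
Proof. by rewrite gop_lineE -lup_pred [lup m n]lupE. Qed.

Lemma line_jacobi_deltaE m n :
  line_jacobi_delta d lambda beta m n = gop line_nb (delta m) n.
Proof.
rewrite gop_line_delta /line_jacobi_delta -/s -/(lup m n).
rewrite (diag_sym beta m n) [delta n m]delta_sym [delta m.+1 n]delta_sym -lupE.
by ring.
Qed.

Lemma gop_line_sym m n : gop line_nb (delta m) n = gop line_nb (delta n) m.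
Proof.
rewrite !gop_line_delta [delta m n]delta_sym (diag_sym beta n m).
by rewrite [delta m n]delta_sym; ring.
Qed.

Lemma tree_jacobiE : tree_jacobi d lambda beta = gop_finsupp tree_nb.
Proof. exact: operator_on_basisE tree_jacobi_deltaE. Qed.

Lemma line_jacobiE : line_jacobi d lambda beta = gop_finsupp line_nb.
Proof. exact: operator_on_basisE line_jacobi_deltaE. Qed.

(** * Radial sums and radial lifts *)

Let t : R[i] := (s^-1)%:C.

Let st : s%:C * t = 1. Proof. by rewrite -rmorphM divff. Qed.

Let dC : (d%:R : R[i]) = s%:C ^+ 2.
Proof. by rewrite -rmorphXn s_sqr rmorph_nat. Qed.

Let csq_t k (c : R[i]) : csq (t ^+ k * c) = d%:R^-1 ^+ k * csq c.
Proof.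
by rewrite csqM -rmorphXn csqR -exprM mulnC exprM [_^-1 ^+ 2]exprVn s_sqr.
Qed.

Let d_neq0 : (d%:R : R) != 0. Proof. by rewrite pnatr_eq0 -lt0n. Qed.

(* The factors [t = 1 / sqrt d] make [radial_lift] isometric. *)
Definition radial_sum y F n : R[i] :=
  if (size y <= n)%N then t ^+ (n - size y) * iter (n - size y) (@chsum d R[i]) F y
  else 0.

Definition radial_lift y g x : R[i] :=
  if suffix y x then t ^+ (size x - size y) * g (size x) else 0.

Lemma radial_sumE y F k :
  radial_sum y F (k + size y) = t ^+ k * iter k (@chsum d R[i]) F y.
Proof. by rewrite /radial_sum leq_addl addnK. Qed.

Lemma radial_liftE y g w :
  radial_lift y g (w ++ y) = t ^+ size w * g (size w + size y)%N.
Proof. by rewrite /radial_lift suffix_suffix size_cat addnK. Qed.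

Lemma radial_sumB y F G :
  radial_sum y (F \- G) = radial_sum y F \- radial_sum y G.
Proof.
apply/funext => n /=; rewrite /radial_sum; case: ifP => _; last by rewrite subrr.
by rewrite iter_chsumB mulrBr.
Qed.

Lemma radial_liftB y g h :
  radial_lift y (g \- h) = radial_lift y g \- radial_lift y h.
Proof.
apply/funext => x /=; rewrite /radial_lift; case: ifP => _; last by rewrite subrr.
by rewrite mulrBr.
Qed.

(** Cauchy-Schwarz over the [d ^ k] descendants of [y] at depth [k] costs [d ^ k], which the squared
    factor [t ^ k] cancels. *)
Lemma sqnorm_radial_sum y F : (sqnorm (radial_sum y F) <= sqnorm F)%E.
Proof.
have addI : injective (addn^~ (size y)) by exact: addIn.
have catI : injective (cat^~ y) by exact: cat_left_inj.
rewrite !sqnormE (esum_comp addI); last 2 first.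
- by move=> n; rewrite lee_fin csq_ge0.
- move=> n nr; rewrite /radial_sum; case: leqP => [yn|_]; last by rewrite csq0.
  by case: nr; exists (n - size y)%N => //=; rewrite subnK.
have csqF0 x : (0 <= (csq (F x))%:E)%E by rewrite lee_fin csq_ge0.
apply: le_trans (esum_comp_le catI csqF0).
rewrite (esum_subtree (a := fun x => csq (F x))); last by move=> x; exact: csq_ge0.
apply: le_esum => k _; rewrite lee_fin radial_sumE csq_t.
have dk0 : 0 <= d%:R^-1 ^+ k :> R by rewrite exprn_ge0 // invr_ge0 ler0n.
apply: le_trans (ler_wpM2l dk0 (csq_iter_chsum F k y)) _.
by rewrite mulrA -exprMn mulVf // expr1n mul1r.
Qed.

(** Each of the [d ^ k] vertices at depth [k] below [y] carries the fraction [1 / d ^ k] of the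
    squared modulus of [g] at level [size y + k]; only levels less than [size y] are lost. *)
Lemma sqnorm_radial_lift y g : (sqnorm (radial_lift y g) <= sqnorm g)%E.
Proof.
have addI : injective (addn^~ (size y)) by exact: addIn.
have catI : injective (cat^~ y) by exact: cat_left_inj.
rewrite !sqnormE (esum_comp catI); last 2 first.
- by move=> x; rewrite lee_fin csq_ge0.
- move=> x xr; rewrite /radial_lift; case: ifP => [/suffixP[w xw]|_]; last first.
    by rewrite csq0.
  by case: xr; exists w.
have csqg0 n : (0 <= (csq (g n))%:E)%E by rewrite lee_fin csq_ge0.
apply: le_trans (esum_comp_le addI csqg0).
rewrite (esum_tree (a := fun w => csq (radial_lift y g (w ++ y)))); last first.
  by move=> x; exact: csq_ge0.
apply: le_esum => k _; rewrite lee_fin.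
pose h n := d%:R^-1 ^+ n * csq (g (n + size y)%N).
rewrite (@eq_iter_chsum _ _ _ (fun x => h (size x))); last first.
  by move=> w _; rewrite radial_liftE csq_t.
rewrite iter_chsum_level /h /= -[_ *+ _]mulr_natl natrX mulrA -exprMn.
by rewrite divff // expr1n mul1r.
Qed.

Lemma finsupp_radial_sum F : finsupp F -> finsupp (radial_sum [::] F).
Proof.
move=> /(finsupp_bound size)[M FM].
apply: (@sub_finite_set _ _ `I_M.+1); last exact: finite_II.
move=> n /=; apply: contraR; rewrite -leqNgt => Mn.
rewrite /radial_sum /= (@eq_iter_chsum _ _ _ (fun=> 0)).
  by rewrite (iter_chsum_level (fun=> 0)) mul0rn mulr0.
by move=> w wn; apply: FM; rewrite cats0 wn subn0.
Qed.

Lemma finsupp_radial_lift y g : finsupp g -> finsupp (radial_lift y g).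
Proof.
move=> /(finsupp_bound id)[M gM]; apply: sub_finite_set (finite_level M).
move=> x /=; apply: contraR; rewrite -ltnNge => Mx.
by rewrite /radial_lift gM // mulr0 if_same.
Qed.

Let ttd : t * t * d%:R = 1.
Proof. by rewrite dC expr2 mulrACA ![t * _]mulrC st mulr1. Qed.

(** At level [n] the factor [t ^ n] enters twice, against [d ^ n] vertices. *)
Lemma radial_liftK g : radial_sum [::] (radial_lift [::] g) = g.
Proof.
apply/funext => n; rewrite /radial_sum /= subn0.
rewrite (@eq_iter_chsum _ _ _ (fun x => t ^+ size x * g (size x))).
  rewrite (iter_chsum_level (fun n => t ^+ n * g n)) /= -[_ *+ _]mulr_natr natrX.
  transitivity ((t * t * d%:R) ^+ n * g n); last by rewrite ttd expr1n mul1r.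
  by rewrite !exprMn; ring.
by move=> w _; rewrite cats0 /radial_lift suffix0s subn0.
Qed.

Let td : t * d%:R = s%:C.
Proof. by rewrite dC expr2 mulrA [t * _]mulrC st mul1r. Qed.

(** Each vertex is the parent of [d] vertices in the next generation, hence the factor [d].
    Generation 0 is excluded because the parent of [y] is not a descendant of [y]. *)
Lemma iter_chsum_gop F y k :
  iter k.+1 (@chsum d R[i]) (gop tree_nb F) y =
  (lambda (size y + k))%:C * (d%:R * iter k (@chsum d R[i]) F y) +
  (beta (size y + k.+1))%:C * iter k.+1 (@chsum d R[i]) F y +
  (lambda (size y + k.+1))%:C * iter k.+2 (@chsum d R[i]) F y.
Proof.
elim: k y => [|k IH] y.
  rewrite /= {1}/chsum; under eq_bigr do rewrite gop_treeE /=.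
  by rewrite !big_split /= -!mulr_sumr sumr_const card_ord -[_ *+ d]mulr_natl
    addn0 addn1.
rewrite iterS {1}/chsum; under eq_bigr do rewrite IH.
by rewrite !big_split /= -!mulr_sumr !addSnnS.
Qed.

(** This is [iter_chsum_gop] rescaled: [t * d = s] adjusts the parent term and [s * t = 1] the child
    term. At [n = size y] the parent of [y] would interfere, hence the strict inequality. *)
Lemma radial_sum_gop y F n : (size y < n)%N ->
  gop line_nb (radial_sum y F) n = radial_sum y (gop tree_nb F) n.
Proof.
move=> yn; have -> : n = ((n - (size y).+1).+1 + size y)%N by rewrite addSnnS subnK.
move: (n - _)%N => k.
have E1 G : radial_sum y G (k + size y).+1 = t ^+ k.+1 * iter k.+1 (@chsum d R[i]) G y.
  by rewrite -addSn radial_sumE.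
have E2 : radial_sum y F (k + size y).+2 = t ^+ k.+2 * iter k.+2 (@chsum d R[i]) F y.
  by rewrite -2!addSn radial_sumE.
rewrite addSn gop_lineE succnK radial_sumE !E1 E2 iter_chsum_gop.
rewrite addnS [(size y + k)%N]addnC /lambda_pred !rmorphM.
move: (iter k _ F y) (iter k.+1 _ F y) (iter k.+2 _ F y) => a b c.
transitivity ((lambda (k + size y))%:C * (t * d%:R) * t ^+ k * a +
  (beta (k + size y).+1)%:C * t * t ^+ k * b +
  (lambda (k + size y).+1)%:C * (s%:C * t) * t * t ^+ k * c).
  by rewrite td !exprS; ring.
by rewrite st !exprS; ring.
Qed.

(** From the root, commutation extends to level 0, where the parent weight is zero on both sides. *)
Lemma radial_sum_root_gop F :
  gop line_nb (radial_sum [::] F) = radial_sum [::] (gop tree_nb F).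
Proof.
apply/funext => -[|n]; last exact: radial_sum_gop.
rewrite gop_lineE /radial_sum /= gop_treeE /= mulr0 !mul0r !add0r !mul1r.
rewrite rmorphM /= expr1 mulrA; congr (_ + _ * _).
by rewrite mulrAC st mul1r.
Qed.

(** Two boundary terms arise on the edge above [y]: the parent of [y] sees the value at [y], while
    [y] sees 0 where the line operator sees [g (size y).-1]. Both contain [lambda_pred (size y)] and
    vanish when [y] is the root. *)
Lemma radial_lift_gop y g : gop tree_nb (radial_lift y g) =
  (radial_lift y (gop line_nb g) \+
   (fun x => (lambda_pred (size y))%:C * g (size y) * delta (behead y) x)) \-
  (fun x => (s * lambda_pred (size y))%:C * g (size y).-1 * delta y x).
Proof.
apply/funext => x /=; rewrite gop_treeE.
have size_neq (u v : tree d) : (size v < size u)%N -> u != v.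
  by apply: contraTneq => ->; rewrite ltnn.
have lift_child (i : 'I_d) w :
    radial_lift y g (i :: w ++ y) = t ^+ (size w).+1 * g (size w + size y).+1.
  by rewrite -[i :: w ++ y]/((i :: w) ++ y) radial_liftE.
have lift_root h : radial_lift y h y = h (size y).
  by rewrite (radial_liftE y h [::]) mul1r.
have not_suffix h z : ~~ suffix y z -> radial_lift y h z = 0.
  by rewrite /radial_lift => /negbTE ->.
have [/suffixP[[|j w] ->]|yx] := boolP (suffix y x).
(* Case [x = y]: the correction at [y] cancels the backward term of the line operator. *)
- rewrite /= !lift_root gop_lineE deltaxx mulr1.
  have -> : chsum (radial_lift y g) y = s%:C * g (size y).+1.
    rewrite /chsum (eq_bigr (fun=> t * g (size y).+1)); last first.
      by move=> i _; rewrite (lift_child i [::]) expr1.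
    by rewrite sumr_const card_ord -[_ *+ d]mulr_natl mulrA [_ * t]mulrC td.
  have -> : (lambda_pred (size y))%:C * radial_lift y g (behead y) = 0.
    case: y not_suffix {lift_child lift_root} => [|j y0] not_suffix; first by rewrite mul0r.
    rewrite not_suffix ?mulr0 //; apply/negP => /suffixP[w /(congr1 size)].
    by rewrite size_cat /=; lia.
  have -> : (lambda_pred (size y))%:C * g (size y) * delta (behead y) y = 0.
    case: y {lift_child lift_root not_suffix} => [|j y0]; first by rewrite !mul0r.
    by rewrite delta_neq ?mulr0 //; apply: size_neq.
  by rewrite !rmorphM /=; ring.
(* Proper descendants: all neighbours lie in the subtree and both corrections vanish. *)
- have yw : (size y < size ((j :: w) ++ y))%N by rewrite /= size_cat ltnS leq_addl.
  rewrite [delta y _]delta_neq; last exact: size_neq.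
  rewrite delta_neq; last first.
    by apply: size_neq; apply: leq_ltn_trans yw; rewrite size_behead leq_pred.
  rewrite !mulr0 addr0 subr0 !radial_liftE gop_lineE.
  have -> : chsum (radial_lift y g) ((j :: w) ++ y) =
      s%:C * (t ^+ (size w).+1 * g (size w + size y).+2).
    rewrite /chsum (eq_bigr (fun=> t ^+ (size w).+2 * g (size w + size y).+2)); last first.
      by move=> i _; rewrite (lift_child i (j :: w)).
    by rewrite sumr_const card_ord -[_ *+ d]mulr_natl -td !exprS; ring.
  rewrite /= size_cat [in LHS]exprS !rmorphM /=.
  move: (lambda _)%:C (beta _)%:C (lambda _)%:C (g _) (g _) (g _) => l' b l a2 a1 a0.
  transitivity (s%:C * t * (t ^+ size w * l * a0) + b * (t ^+ (size w).+1 * a1)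
    + s%:C * l' * (t ^+ (size w).+1 * a2)).
    by rewrite st !exprS; ring.
  by rewrite !exprS; ring.
(* Outside the subtree the only possible neighbour inside it is [y] as a child, which forces
   [x = behead y]. *)
- rewrite (not_suffix _ x yx) (not_suffix _ x yx) mulr0 add0r addr0.
  rewrite not_suffix; last first.
    apply: contraNN yx; case: x => //= i x /suffix_trans; apply; exact: suffix_cons.
  rewrite mulr0 add0r [delta y x]delta_neq; last first.
    by apply: contraNneq yx => ->; exact: suffix_refl.
  rewrite mulr0 subr0.
  have child i : suffix y (i :: x) -> y = i :: x.
    by case/suffixP => -[|k w] //= [_ xw]; rewrite xw suffix_suffix in yx.
  have [xb|xb] := eqVneq x (behead y); last first.
    rewrite [delta _ _]delta_neq // mulr0 /chsum big1 ?mulr0 // => i _.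
    by apply: not_suffix; apply: contraNN xb => /child ->.
  case: y xb yx lift_root not_suffix child {lift_child} => [|j y0] /= xb yx.
    by rewrite suffix0s in yx.
  rewrite xb deltaxx mulr1 => lift_root not_suffix child; congr (_ * _).
  rewrite /chsum (bigD1 j) //= lift_root /= big1 ?addr0 // => i ij.
  by apply: not_suffix; apply/negP => /child[ji]; rewrite ji eqxx in ij.
Qed.

End jacobi_graphs.

Arguments line_nb {R} d lambda beta.

(** * Level averages and the equivalence *)

Section main.
Context {R : realType} {d : nat}.
Variables (lambda beta : nat -> R).
Hypothesis d_gt0 : (0 < d)%N.
Implicit Types (x y z w : tree d) (F G : tree d -> R[i]) (g h : nat -> R[i]).

Local Notation Tt := (gop (tree_nb lambda beta)).
Local Notation Tl := (gop (line_nb d lambda beta)).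

Lemma sqnorm_delta (X : choiceType) (c : R[i]) (p : X) :
  sqnorm (fun q => c * delta p q) = (csq c)%:E.
Proof.
rewrite sqnormE (esumID [set p]) //; last by move=> q _; rewrite lee_fin csq_ge0.
rewrite setTI esum_set1 ?lee_fin ?csq_ge0 // deltaxx mulr1 setTI esum1 ?adde0 //.
by move=> q /= /eqP qp; rewrite delta_neq // mulr0 csq0.
Qed.

(** The lift of an approximant [u] of [g] works: lifting is a contraction, and each boundary term
    involves a single value of [u \- g], bounded by its norm. *)
Lemma approximable_radial_lift y g : approximable (line_nb d lambda beta) g ->
  approximable (tree_nb lambda beta) (radial_lift y g).
Proof.
move=> ag eps e0.
pose lp := (lambda_pred lambda (size y))%:C.
pose slp := (Num.sqrt d%:R * lambda_pred lambda (size y))%:C.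
(* [K] bounds the squared moduli of both boundary coefficients and is at least 1, so dividing by it
   also suits the lifted terms. *)
pose K := 1 + csq lp + csq slp.
have K1 : 1 <= K by rewrite /K -addrA lerDl addr_ge0 ?csq_ge0.
have K0 : 0 < K := lt_le_trans ltr01 K1.
(* Two nested uses of [sqnormD_lt] combine the three terms of [radial_lift_gop], hence the 16. *)
have r0 : 0 < eps / 16 / K by rewrite !divr_gt0.
have [u [fu ug Tug]] := ag _ r0; exists (radial_lift y u).
rewrite -radial_liftB radial_lift_gop //.
have small c n : csq c <= K -> csq (c * (u \- g) n) < eps / 16.
  move=> cK; have wn : csq ((u \- g) n) < eps / 16 / K.
    by rewrite -lte_fin; apply: le_lt_trans ug; exact: sqnorm_point.
  rewrite csqM; apply: le_lt_trans (ler_wpM2r (csq_ge0 _) cK) _.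
  by rewrite mulrC -ltr_pdivlMr.
have e16 : eps / 16 / K <= eps / 16.
  by rewrite ler_pdivrMr // ler_peMr // divr_ge0 // ltW.
have e4 : eps / 4 / 4 = eps / 16 by field.
split; first exact: finsupp_radial_lift.
  apply: le_lt_trans (sqnorm_radial_lift d_gt0 _ _) (lt_le_trans ug _).
  by rewrite lee_fin; lra.
apply: sqnormD_lt; last first.
  rewrite sqnormN sqnorm_delta lte_fin; apply: lt_trans (small _ _ _) _.
    by rewrite lerDr addr_ge0 ?csq_ge0.
  lra.
apply: sqnormD_lt; rewrite e4.
  apply: le_lt_trans (sqnorm_radial_lift d_gt0 _ _) (lt_le_trans Tug _).
  by rewrite lee_fin.
rewrite sqnorm_delta lte_fin; apply: small.
by rewrite /K addrAC lerDr addr_ge0 ?csq_ge0.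
Qed.

(** [drop (size x - N) x] is the ancestor of [x] at level [N]. Below level [N] this is the
    conditional expectation of [F] given that ancestor and the depth. *)
Definition level_avg N F x : R[i] :=
  if (size x <= N)%N then F x else
  d%:R^-1 ^+ (size x - N) * iter (size x - N) (@chsum d R[i]) F (drop (size x - N) x).

Lemma level_avg_le N F x : (size x <= N)%N -> level_avg N F x = F x.
Proof. by rewrite /level_avg => ->. Qed.

Lemma level_avg_cat F w y :
  level_avg (size y) F (w ++ y) = d%:R^-1 ^+ size w * iter (size w) (@chsum d R[i]) F y.
Proof.
rewrite /level_avg size_cat addnK drop_size_cat //; case: leqP => // wy.
have /eqP -> : w == [::] by rewrite -size_eq0 -leqn0 -(leq_add2r (size y)).
by rewrite mul1r.
Qed.

Lemma level_split N x : (N <= size x)%N -> exists w y, x = w ++ y /\ size y = N.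
Proof.
move=> Nx; exists (take (size x - N) x), (drop (size x - N) x).
by rewrite cat_take_drop size_drop subKn.
Qed.

Lemma level_avgB N F G : level_avg N (F \- G) = level_avg N F \- level_avg N G.
Proof.
apply/funext => x /=; rewrite /level_avg; case: ifP => // _.
by rewrite iter_chsumB mulrBr.
Qed.

Let dC_neq0 : (d%:R : R[i]) != 0. Proof. by rewrite pnatr_eq0 -lt0n. Qed.

(** The [d] children share one value, so their number cancels one factor of the normalization. *)
Lemma chsum_level_avg F w y : chsum (level_avg (size y) F) (w ++ y) =
  d%:R^-1 ^+ size w * iter (size w).+1 (@chsum d R[i]) F y.
Proof.
rewrite /chsum (eq_bigr (fun=> d%:R^-1 ^+ (size w).+1 *
    iter (size w).+1 (@chsum d R[i]) F y)).
  rewrite sumr_const card_ord -[_ *+ d]mulr_natl exprS mulrA mulrA.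
  by rewrite divff // mul1r.
by move=> i _; rewrite -cat_cons level_avg_cat.
Qed.

(** The coefficients depend on the level only, so averages below a level-[N] vertex obey the
    recursion [iter_chsum_gop]. *)
Lemma level_avg_gop N F : Tt (level_avg N F) = level_avg N (Tt F).
Proof.
apply/funext => x; rewrite gop_treeE //.
have [xN|Nx] := leqP (size x) N.
  rewrite !level_avg_le //; last by rewrite size_behead (leq_trans (leq_pred _)).
  rewrite gop_treeE //; congr (_ + _ * _).
  (* At level [N] the children already carry averages, but taken over the children of [x] alone, so
     their sum is unchanged. *)
  move: xN; rewrite leq_eqVlt => /orP[/eqP <-|xN].
    by rewrite -[x in chsum _ x]/([::] ++ x) chsum_level_avg mul1r.
  by apply: eq_bigr => i _; rewrite level_avg_le.
have [w [y [xE yN]]] := level_split (ltnW Nx); subst N x.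
case: w Nx => [|j w] Nx; first by rewrite ltnn in Nx.
rewrite !level_avg_cat chsum_level_avg -[size (j :: w)]/(size w).+1.
rewrite iter_chsum_gop //= size_cat !addnS [(size y + _)%N]addnC.
set a := iter _ _ _ _; set b := chsum _ _; set c := chsum _ _.
set l := (lambda _)%:C; set b' := (beta _)%:C; set l' := (lambda _.+1)%:C.
move: a b c l b' l' => a b c l b' l'; rewrite exprS.
transitivity (d%:R^-1 * d%:R * (l * (d%:R^-1 ^+ size w * a)) +
  b' * (d%:R^-1 * d%:R^-1 ^+ size w * b) + l' * (d%:R^-1 * d%:R^-1 ^+ size w * c)).
  by rewrite mulVf // mul1r.
move: (d%:R^-1) (d%:R^-1 ^+ size w) => q qk; ring.
Qed.

(** Levels up to [N] are untouched; further down, averaging under each level-[N] vertex cannot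
    increase the sum of squares, by Cauchy-Schwarz. *)
Lemma sqnorm_level_avg N F : (sqnorm (level_avg N F) <= sqnorm F)%E.
Proof.
have sq0 G x : 0 <= csq (G x) by exact: csq_ge0.
rewrite !sqnormE !(esum_tree (a := fun x => csq (_ x))) //.
apply: le_esum => n _; rewrite lee_fin.
have [nN|Nn] := leqP n N.
  apply: le_iter_chsum => w wn.
  by rewrite level_avg_le // cats0 wn.
rewrite -(subnKC (ltnW Nn)) !iter_chsumD; apply: le_iter_chsum => y.
rewrite cats0; move: (n - N)%N => k yN; subst N.
rewrite (@eq_iter_chsum _ _ _ (fun=> csq (d%:R^-1 ^+ k * iter k (@chsum d R[i]) F y))).
  move: (iter_chsum_level (fun=> csq (d%:R^-1 ^+ k * iter k (@chsum d R[i]) F y)) k y).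
  move=> ->; rewrite csqM -[_ *+ _]mulr_natl natrX.
  have -> : (d%:R^-1 : R[i]) ^+ k = (d%:R^-1 ^+ k)%:C.
    by rewrite rmorphXn fmorphV rmorph_nat.
  have dR_neq0 : (d%:R : R) != 0 by rewrite pnatr_eq0 -lt0n.
  have dk1 : (d%:R ^+ k * d%:R^-1 ^+ k : R) = 1 by rewrite -exprMn divff // expr1n.
  have dk0 : 0 <= d%:R^-1 ^+ k :> R by rewrite exprn_ge0 // invr_ge0 ler0n.
  rewrite csqR expr2 !mulrA dk1 mul1r.
  apply: le_trans (ler_wpM2l dk0 (csq_iter_chsum F k y)) _.
  by rewrite mulrA [X in X * _]mulrC dk1 mul1r.
by move=> w wk; rewrite level_avg_cat wk.
Qed.

(** The first term stops strictly before level [N], since a level-[N] vertex belongs to its own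
    subtree. Sum and lift contribute [t ^ k] each, together the averaging weight [1 / d ^ k]. *)
Lemma level_avgE N F : level_avg N F =
  (fun x => if (size x < N)%N then F x else 0) \+
  (fun x => \sum_(y : N.-tuple 'I_d) radial_lift y (radial_sum y F) x).
Proof.
apply/funext => x /=; have [xN|Nx] := leqP N (size x); last first.
  rewrite level_avg_le ?(ltnW Nx) // big1 ?addr0 // => y _.
  rewrite /radial_lift; case: ifP => // /size_suffix.
  by rewrite size_tuple leqNgt Nx.
have [w [y [-> yN]]] := level_split xN; rewrite add0r.
rewrite (bigD1 (Tuple (introT eqP yN))) //= big1 ?addr0; last first.
  move=> z zy; rewrite /radial_lift; case: ifP => // /suffixP[v vz].
  case/eqP: zy; apply: val_inj => /=.
  have : w ++ y == v ++ z by rewrite vz.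
  rewrite eqseq_cat; first by case/andP => _ /eqP.
  move/(congr1 size): vz; rewrite !size_cat size_tuple yN; lia.
rewrite radial_liftE radial_sumE // -{1}yN level_avg_cat mulrA; congr (_ * _).
by rewrite -exprMn -rmorphM -invfM -expr2 sqr_sqrtr ?ler0n // fmorphV rmorph_nat.
Qed.

(** A finitely supported [G] is fixed once [N] exceeds its deepest level; density transfers this to
    [F] because every [level_avg N] is a contraction. *)
Lemma level_avg_cvg F (eps : R) : l2 F -> 0 < eps -> exists N0,
  forall N, (N0 <= N)%N -> (sqnorm (level_avg N F \- F)%R < eps%:E)%E.
Proof.
move=> lF e0; have e4 : 0 < eps / 4 by rewrite divr_gt0.
have [G [/(finsupp_bound size)[M GM] GF]] := finsupp_dense lF e4.
exists M.+1 => N MN; have GE : level_avg N G = G.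
  apply/funext => x; have [xN|Nx] := leqP (size x) N; first exact: level_avg_le.
  have [w [y [xE yN]]] := level_split (ltnW Nx); subst N x.
  rewrite level_avg_cat [RHS]GM ?(leq_trans MN (ltnW Nx)) //.
  rewrite (@eq_iter_chsum _ _ _ (fun=> 0)).
    by rewrite (iter_chsum_level (fun=> 0)) mul0rn mulr0.
  by move=> v vw; apply: GM; rewrite size_cat (leq_trans MN) // leq_addl.
have -> : level_avg N F \- F = (\- level_avg N (G \- F)) \+ (G \- F).
  by rewrite level_avgB GE; apply/funext => x /=; ring.
apply: sqnormD_lt => //; rewrite sqnormN.
exact: le_lt_trans (sqnorm_level_avg _ _) GF.
Qed.

Lemma essentially_selfadjoint_tree_line :
  essentially_selfadjoint (tree_jacobi d lambda beta) <->
  essentially_selfadjoint (line_jacobi d lambda beta).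
Proof.
rewrite tree_jacobiE line_jacobiE.
rewrite (essentially_selfadjointP (gop_tree_sym lambda beta)).
rewrite (essentially_selfadjointP (@gop_line_sym R d lambda beta)).
split=> [esa g lg lTg eps e0|esa F lF lTF].
  pose root : tree d := [::].
  (* At the root both boundary terms have weight zero, so lifting commutes exactly. *)
  have lift_gop h : Tt (radial_lift root h) = radial_lift root (Tl h).
    rewrite radial_lift_gop //.
    by apply/funext => x /=; rewrite mulr0 !mul0r addr0 subr0.
  have [||U [fU Ug TUg]] := esa (radial_lift root g) _ _ _ e0.
  - exact: le_lt_trans (sqnorm_radial_lift d_gt0 _ _) lg.
  - by rewrite lift_gop; exact: le_lt_trans (sqnorm_radial_lift d_gt0 _ _) lTg.
  (* Radial sums undo the lift and contract, so they bring the approximant back to the line. *)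
  exists (radial_sum root U); rewrite -{1 2}(radial_liftK d_gt0 g) -radial_sumB.
  rewrite radial_sum_root_gop //; split.
  - exact: finsupp_radial_sum.
  - exact: le_lt_trans (sqnorm_radial_sum d_gt0 _ _) Ug.
  - exact: le_lt_trans (sqnorm_radial_sum d_gt0 _ _) TUg.
apply: approximable_limit => eps e0.
have [N1 H1] := level_avg_cvg lF e0; have [N2 H2] := level_avg_cvg lTF e0.
(* The larger index serves [F] and [Tt F] at once. *)
exists (level_avg (maxn N1 N2) F); split; first last.
- by rewrite gopB level_avg_gop; apply: H2; exact: leq_maxr.
- by apply: H1; exact: leq_maxl.
rewrite level_avgE; apply: approximableD.
  apply: finsupp_approximable; apply: sub_finite_set (finite_level (maxn N1 N2)).
  by move=> x /=; case: ltnP => [/ltnW //|_]; rewrite eqxx.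
apply: approximable_sum => y; apply: approximable_radial_lift; apply: esa.
  exact: le_lt_trans (sqnorm_radial_sum d_gt0 _ _) lF.
(* Commutation is known only beyond level [size y]; finitely many levels remain. *)
apply: (@l2_eqoff _ _ [set n | (n <= size y)%N] _ (radial_sum y (Tt F))).
- exact: finite_II (size y).+1.
- by move=> n /= /negP; rewrite -ltnNge => yn; rewrite radial_sum_gop.
exact: le_lt_trans (sqnorm_radial_sum d_gt0 _ _) lTF.
Qed.

End main.

Theorem theorem1p8 (R : realType) (d : nat) (hd : (2 <= d)%N)
    (lambda beta : nat -> R) (hlambda : forall n : nat, 0 < lambda n) :
  essentially_selfadjoint (tree_jacobi d lambda beta) <->
  essentially_selfadjoint (line_jacobi d lambda beta).
Proof. exact: essentially_selfadjoint_tree_line (ltnW hd). Qed.
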